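(* Let $K$ be a field of characteristic zero, let $A:=A_n\otimes P_m$ be the $n$'th Weyl algebra with polynomial coefficients over $K$, let $s:=2n+m$, and let $\widehat A:=A[[\partial_1,\ldots,\partial_s]]=\mathrm{End}_K(A)$. For any $a\in\widehat A=\mathrm{End}_K(A)$, $$a=\sum_{\alpha\in\mathbb N^s}\Psi\Big(\frac{D^\alpha}{\alpha!}a\Big)\partial^\alpha.$$
   Context: The Weyl algebra $A_n$ is the $K$-algebra generated by $x_1,\ldots,x_{2n}$ subject to $[x_{n+i},x_j]=\delta_{ij}$ (Kronecker delta), $[x_i,x_j]=[x_{n+i},x_{n+j}]=0$ for $1\le i,j\le n$, where $[a,b]=ab-ba$; $P_m=K[x_{2n+1},\ldots,x_{2n+m}]$ is a polynomial algebra. $\partial_1,\ldots,\partial_s$ are the formal partial derivatives of $A$: the commuting locally nilpotent $K$-derivations with $\partial_i(x_j)=\delta_{ij}$. $\widehat A=A[[\partial_1,\ldots,\partial_s]]$ consists of formal (possibly infinite) series $\sum_{\alpha\in\mathbb N^s}a_\alpha\partial^\alpha$, $a_\alpha\in A$, $\partial^\alpha=\partial_1^{\alpha_1}\cdots\partial_s^{\alpha_s}$, multiplied using commuting $\partial_i$'s and $\partial_ia=a\partial_i+\partial_i(a)$, $a\in A$; acting on $A$ by $b\mapsto\sum_\alpha a_\alpha\partial^\alpha(b)$ it is identified with the algebra $\mathrm{End}_K(A)$ of all $K$-linear endomorphisms of $A$ (every $K$-linear map is uniquely such a series). $\widehat A$ is complete in the topology given by the left ideals $\mathfrak m^{[i]}=\sum_{|\alpha|\ge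 i}\widehat A\partial^\alpha$, $i\ge 0$. $D_i$ ($i=1,\ldots,s$) is the continuous $A$-derivation of $\widehat A$ (zero on $A$) with $D_i(\partial_j)=\delta_{ij}$; $D^\alpha=D_1^{\alpha_1}\cdots D_s^{\alpha_s}$, $\alpha!=\alpha_1!\cdots\alpha_s!$. Put $\Psi_i(u)=\sum_{k\ge0}(-1)^kD_i^k(u)\frac{\partial_i^k}{k!}$ for $u\in\widehat A$ and $\Psi=\Psi_1\Psi_2\cdots\Psi_s:\widehat A\to\widehat A$ (composition); $\Psi$ maps $\widehat A$ onto $A$. *)

(* Defs.v *)
From HB Require Import structures.
From mathcomp Require Import all_boot all_order all_algebra.
From mathcomp Require Import boolp.
From mathcomp.multinomials Require Import mpoly.

Set Implicit Arguments.
Unset Strict Implicit.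
Unset Printing Implicit Defensive.

Import GRing.Theory.
Local Open Scope ring_scope.

(* The algebra End_K(A), with composition as product.  It also represents the
   algebra A[[d_1, ..., d_s]] of formal series: the series with coefficients
   a_al is the K-linear map b |-> \sum_al a_al * d^al(b), and a coefficient
   a : A is the left multiplication lmul a. *)

Record endo (K : fieldType) (A : algType K) : Type :=
  Endo { endo_lin :> {linear A -> A} }.

Section EndoAlgebra.
Variables (K : fieldType) (A : algType K).
Implicit Types u v w : endo A.

Lemma endoP u v : u =1 v -> u = v.
Proof.
case: u v => [[f [[f1] [f2]]]] [[g [[g1] [g2]]]] /= /funext fg.
rewrite /= in fg; case: _ / fg g1 g2 => g1 g2.
by rewrite (Prop_irrelevance f1 g1) (Prop_irrelevance f2 g2).
Qed.

HB.instance Definition _ := gen_eqMixin (endo A).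
HB.instance Definition _ := gen_choiceMixin (endo A).

Definition endo_zero : endo A := Endo (\0 : {linear A -> A}).
Definition endo_one : endo A := Endo (idfun : {linear A -> A}).
Definition endo_opp u : endo A := Endo ((\- u) : {linear A -> A}).
Definition endo_add u v : endo A := Endo ((u \+ v) : {linear A -> A}).
Definition endo_comp u v : endo A := Endo ((u \o v) : {linear A -> A}).
Definition endo_scale (k : K) u : endo A := Endo ((k \*: u) : {linear A -> A}).


Fact endo_addA : associative endo_add.
Proof. by move=> u v w; apply: endoP => a /=; rewrite addrA. Qed.
Fact endo_addC : commutative endo_add.
Proof. by move=> u v; apply: endoP => a /=; rewrite addrC. Qed.
Fact endo_add0 : left_id endo_zero endo_add.
Proof. by move=> u; apply: endoP => a /=; rewrite add0r. Qed.
Fact endo_addN : left_inverse endo_zero endo_opp endo_add.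
Proof. by move=> u; apply: endoP => a /=; rewrite addNr. Qed.

HB.instance Definition _ :=
  GRing.isZmodule.Build (endo A) endo_addA endo_addC endo_add0 endo_addN.

Fact endo_compA : associative endo_comp.
Proof. by move=> u v w; apply: endoP. Qed.
Fact endo_comp1l : left_id endo_one endo_comp.
Proof. by move=> u; apply: endoP. Qed.
Fact endo_comp1r : right_id endo_one endo_comp.
Proof. by move=> u; apply: endoP. Qed.
Fact endo_compDl : left_distributive endo_comp +%R.
Proof. by move=> u v w; apply: endoP. Qed.
Fact endo_compDr : right_distributive endo_comp +%R.
Proof. by move=> u v w; apply: endoP => a /=; rewrite raddfD. Qed.
Fact endo_one_neq0 : endo_one != 0.
Proof.
apply/eqP => /(congr1 (fun u : endo A => u 1)) /= /eqP.
by rewrite oner_eq0.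
Qed.

HB.instance Definition _ := GRing.Zmodule_isNzRing.Build (endo A)
  endo_compA endo_comp1l endo_comp1r endo_compDl endo_compDr endo_one_neq0.

Fact endo_scaleA k l u : endo_scale k (endo_scale l u) = endo_scale (k * l) u.
Proof. by apply: endoP => a /=; rewrite scalerA. Qed.
Fact endo_scale1 : left_id 1 endo_scale.
Proof. by move=> u; apply: endoP => a /=; rewrite scale1r. Qed.
Fact endo_scaleDr : right_distributive endo_scale +%R.
Proof. by move=> k u v; apply: endoP => a /=; rewrite scalerDr. Qed.
Fact endo_scaleDl u : {morph endo_scale^~ u : k l / k + l}.
Proof. by move=> k l; apply: endoP => a /=; rewrite scalerDl. Qed.

HB.instance Definition _ := GRing.Zmodule_isLmodule.Build K (endo A)
  endo_scaleA endo_scale1 endo_scaleDr endo_scaleDl.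

Fact endo_scaleAl (k : K) u v : k *: (u * v) = (k *: u) * v.
Proof. by apply: endoP. Qed.

HB.instance Definition _ :=
  GRing.Lmodule_isLalgebra.Build K (endo A) endo_scaleAl.

Fact endo_scaleAr (k : K) u v : k *: (u * v) = u * (k *: v).
Proof. by apply: endoP => a /=; rewrite linearZ. Qed.

HB.instance Definition _ :=
  GRing.Lalgebra_isAlgebra.Build K (endo A) endo_scaleAr.

Definition lmul (a : A) : endo A := Endo (a \*o idfun : {linear A -> A}).

End EndoAlgebra.

Definition commutator (R : pzRingType) (a b : R) : R := a * b - b * a.

Definition K_derivation (K : fieldType) (B : algType K) (f : B -> B) : Prop :=
  linear f /\ forall a b, f (a * b) = f a * b + a * f b.

(* Presentations, in the form of universal properties.  The generators x_j and
   x_(n+j) of the Weyl algebra are indexed by lshift n j and rshift n j. *)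

Definition weyl_relations (n : nat) (R : pzRingType)
    (x : 'I_(n + n) -> R) : Prop :=
  forall i j : 'I_n,
    [/\ commutator (x (rshift n i)) (x (lshift n j)) = (i == j)%:R,
        commutator (x (lshift n i)) (x (lshift n j)) = 0
      & commutator (x (rshift n i)) (x (rshift n j)) = 0].

Definition is_weyl_algebra (K : fieldType) (n : nat) (W : algType K)
    (x : 'I_(n + n) -> W) : Prop :=
  weyl_relations x /\
  forall (B : algType K) (y : 'I_(n + n) -> B), weyl_relations y ->
  exists f : {lrmorphism W -> B},
    (forall i, f (x i) = y i) /\
    forall g : {lrmorphism W -> B}, (forall i, g (x i) = y i) -> g =1 f.

Definition is_tensor_algebra (K : fieldType) (A1 A2 A : algType K)
    (i1 : {lrmorphism A1 -> A}) (i2 : {lrmorphism A2 -> A}) : Prop :=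
  (forall a b, i1 a * i2 b = i2 b * i1 a) /\
  forall (B : algType K) (f1 : {lrmorphism A1 -> B}) (f2 : {lrmorphism A2 -> B}),
    (forall a b, f1 a * f2 b = f2 b * f1 a) ->
  exists f : {lrmorphism A -> B},
    ((forall a, f (i1 a) = f1 a) /\ (forall b, f (i2 b) = f2 b)) /\
    forall g : {lrmorphism A -> B},
      (forall a, g (i1 a) = f1 a) -> (forall b, g (i2 b) = f2 b) -> g =1 f.

Definition weyl_poly_gen (K : fieldType) (n m : nat) (W A : algType K)
    (x : 'I_(n + n) -> W) (i1 : {lrmorphism W -> A})
    (i2 : {lrmorphism {mpoly K[m]} -> A}) (i : 'I_(n + n + m)) : A :=
  match split i with
  | inl j => i1 (x j)
  | inr j => i2 'X_j
  end.

Definition formal_partials (K : fieldType) (s : nat) (A : algType K)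
    (x : 'I_s -> A) (d : 'I_s -> endo A) : Prop :=
  [/\ forall i, K_derivation (d i),
      forall i j, d i (x j) = (i == j)%:R,
      forall i j, d i * d j = d j * d i
    & forall i a, exists k, (d i ^+ k) a = 0].

Section FormalSeries.
Variables (K : fieldType) (s : nat) (A : algType K) (d : 'I_s -> endo A).

Definition dpow (al : 'X_{1..s}) : endo A := \prod_(i < s) d i ^+ al i.

(* The left ideal m^[k], the sum of the left ideals generated by the dpow al
   with |al| >= k. *)
Definition mideal (k : nat) (u : endo A) : Prop :=
  exists (r : seq 'X_{1..s}) (c : 'X_{1..s} -> endo A),
    all (fun al => k <= mdeg al)%N r /\ u = \sum_(al <- r) c al * dpow al.

Definition mcontinuous (f : endo A -> endo A) : Prop :=
  forall u k, exists l, forall v, mideal l (v - u) -> mideal k (f v - f u).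

(* Convergence for the topology of the left ideals m^[k], along the finite sets
   of indices. *)
Definition has_msum (I : eqType) (t : I -> endo A) (u : endo A) : Prop :=
  forall k, exists r0 : seq I, forall r : seq I,
    uniq r -> {subset r0 <= r} -> mideal k (\sum_(i <- r) t i - u).

(* Limits are unique: an element of every m^[k] is zero, since the d i commute
   and are locally nilpotent.  The value 0 is a default for divergent sums. *)
Definition msum (I : eqType) (t : I -> endo A) : endo A :=
  if pselect (exists u, has_msum t u) is left e then projT1 (cid e) else 0.

Definition is_D (i : 'I_s) (f : endo A -> endo A) : Prop :=
  [/\ K_derivation f,
      forall a, f (lmul a) = 0,
      forall j, f (d j) = (i == j)%:R
    & mcontinuous f].

Variable D : 'I_s -> endo A -> endo A.

Definition Dpow (al : 'X_{1..s}) : endo A -> endo A :=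
  \big[comp/idfun]_(i < s) iter (al i) (D i).

Definition Psi_ (i : 'I_s) (u : endo A) : endo A :=
  msum (fun k : nat =>
    (-1) ^+ k *: (iter k (D i) u * ((k`!)%:R^-1 *: d i ^+ k))).

Definition Psi : endo A -> endo A := \big[comp/idfun]_(i < s) Psi_ i.

End FormalSeries.

Definition mfactorial (s : nat) (al : 'X_{1..s}) : nat :=
  (\prod_(i < s) (al i)`!)%N.

(* Main.v *)
(* Write R_i for right multiplication by x_i; the R_i commute up to scalars.
   On End_K(A), u |-> [u, R_i] is a derivation which kills the left
   multiplications and maps d_j to delta_ij, and for it Psi(u) commutes with
   every R_i.  As the x_i generate A, Psi(u) is then the left multiplication by
   Psi(u)(1) = u(1).  Since Psi(u) - u lies in m^[1], this shows inductively that
   the series with finitely many terms are dense, so D_i(u) = [u, R_i].  Both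
   sides of the formula are additive and compatible with the ideals m^[k], so it
   suffices to check it on c d^be, where D^al(c d^be)(1) / al! is c if al = be
   and 0 otherwise. *)

Require Import Defs.
From HB Require Import structures.
From mathcomp Require Import all_boot all_order all_algebra.
From mathcomp Require Import boolp.
From mathcomp.multinomials Require Import mpoly.

Set Implicit Arguments.
Unset Strict Implicit.
Unset Printing Implicit Defensive.

Import GRing.Theory.
Local Open Scope ring_scope.

(** * Induction on algebra generators, derived from universal properties *)

Section Subalgebra.
Variables (K : fieldType) (A : algType K) (S : A -> Prop).

(** The closure proofs are arguments of the predicate so that the subalgebra structure can be
    attached to it as an instance. *)
Definition subalg_pred of S 1 & (forall k a b, S a -> S b -> S (k *: a + b))
  & (forall a b, S a -> S b -> S (a * b)) : {pred A} := fun a => `[< S a >].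

Hypotheses (S1 : S 1) (SL : forall k a b, S a -> S b -> S (k *: a + b))
  (SM : forall a b, S a -> S b -> S (a * b)).

Fact subalg_pred_closed : subalg_closed (subalg_pred S1 SL SM).
Proof.
split; rewrite ?unfold_in; first exact/asboolP.
  by move=> k u v /asboolP Su /asboolP Sv; apply/asboolP/SL.
by move=> u v /asboolP Su /asboolP Sv; apply/asboolP/SM.
Qed.

HB.instance Definition _ :=
  GRing.isSubalgClosed.Build K A (subalg_pred S1 SL SM) subalg_pred_closed.

Record subalg :=
  Subalg {subalg_val :> A; _ : subalg_val \in subalg_pred S1 SL SM}.
HB.instance Definition _ := [isSub of subalg for subalg_val].
HB.instance Definition _ := [Choice of subalg by <:].
HB.instance Definition _ := [SubChoice_isSubAlgebra of subalg by <:].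

Definition subalg_incl : subalg -> A := val.

Fact subalg_incl_linear : linear subalg_incl. Proof. by []. Qed.
Fact subalg_incl_monoid_morphism : monoid_morphism subalg_incl.
Proof. by []. Qed.

HB.instance Definition _ := GRing.isLinear.Build K subalg A _ subalg_incl
  subalg_incl_linear.
HB.instance Definition _ := GRing.isMonoidMorphism.Build subalg A subalg_incl
  subalg_incl_monoid_morphism.

Lemma subalgP (a : subalg) : S (subalg_incl a).
Proof. by case: a => a Sa; apply/asboolP. Qed.

Lemma subalg_incl_inj : injective subalg_incl.
Proof. exact: val_inj. Qed.

Lemma mem_subalg a : S a -> exists b, subalg_incl b = a.
Proof.
move=> Sa; have Sa' : a \in subalg_pred S1 SL SM by [exact/asboolP].
by exists (Subalg Sa').
Qed.

End Subalgebra.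
Arguments subalg_incl {K A S} S1 SL SM.

(* The universal property yields a retraction onto the subalgebra S, whose
   composite with the inclusion is the identity by uniqueness. *)
Lemma weyl_algebra_ind (K : fieldType) (n : nat) (W : algType K)
    (w : 'I_(n + n) -> W) (S : W -> Prop) :
    is_weyl_algebra w ->
    S 1 -> (forall k a b, S a -> S b -> S (k *: a + b)) ->
    (forall a b, S a -> S b -> S (a * b)) -> (forall i, S (w i)) ->
  forall a, S a.
Proof.
move=> [relw univ] S1 SL SM Sw a.
have /choice[y yE] i : exists b, subalg_incl S1 SL SM b = w i.
  exact: mem_subalg.
have rely : weyl_relations y.
  move=> i j; have [r1 r2 r3] := relw i j.
  by split; apply: (@subalg_incl_inj _ _ _ S1 SL SM);
    rewrite /commutator rmorphB !rmorphM /= ?rmorph_nat ?rmorph0 !yE.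
have [f [fE _]] := univ _ y rely.
have [g [_ gU]] := univ _ w relw.
have idg := gU idfun (fun=> erefl).
have incg := gU (subalg_incl S1 SL SM \o f : {lrmorphism W -> W}).
have -> : a = subalg_incl S1 SL SM (f a).
  by rewrite [LHS]idg -incg // => i /=; rewrite fE yE.
exact: subalgP.
Qed.

(** The argument for the Weyl algebra again: [i1] and [i2] corestrict to [S], the corestrictions
    still commute, and uniqueness makes the glued map followed by the inclusion the identity. *)
Lemma tensor_algebra_ind (K : fieldType) (A1 A2 A : algType K)
    (i1 : {lrmorphism A1 -> A}) (i2 : {lrmorphism A2 -> A}) (S : A -> Prop) :
    is_tensor_algebra i1 i2 ->
    S 1 -> (forall k a b, S a -> S b -> S (k *: a + b)) ->
    (forall a b, S a -> S b -> S (a * b)) ->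
    (forall a, S (i1 a)) -> (forall a, S (i2 a)) ->
  forall a, S a.
Proof.
move=> [comm univ] S1 SL SM Si1 Si2 a.
set inc := subalg_incl S1 SL SM.
have inc_inj : injective inc by apply: subalg_incl_inj.
have lift (B : algType K) (h : {lrmorphism B -> A}) : (forall b, S (h b)) ->
    exists f : {lrmorphism B -> subalg S1 SL SM}, forall b, inc (f b) = h b.
  move=> Sh; have /choice[f fE] b : exists c, inc c = h b by apply: mem_subalg.
  have flin : linear f.
    by move=> k u v; apply: inc_inj; rewrite fE linearP /= -!fE.
  have fmul : monoid_morphism f.
    by split=> [|u v]; apply: inc_inj; rewrite fE ?rmorph1 // rmorphM /= -!fE.
  pose F : {lrmorphism B -> subalg S1 SL SM} :=
    HB.pack f (GRing.isLinear.Build K B (subalg S1 SL SM) _ f flin)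
      (GRing.isMonoidMorphism.Build B (subalg S1 SL SM) f fmul).
  by exists F.
have [f1 f1E] := lift _ i1 Si1; have [f2 f2E] := lift _ i2 Si2.
have [|f [[fi1 fi2] _]] := univ _ f1 f2.
  move=> u v; apply: inc_inj.
  by rewrite -[LHS]/(inc (f1 u) * inc (f2 v)) f1E f2E comm -f1E -f2E.
have [g [_ gU]] := univ _ i1 i2 comm.
have idg := gU idfun (fun=> erefl) (fun=> erefl).
have incg := gU (subalg_incl S1 SL SM \o f : {lrmorphism A -> A}).
have -> : a = inc (f a).
  by rewrite [LHS]idg -incg // => i /=; rewrite ?fi1 ?fi2 ?f1E ?f2E.
exact: subalgP.
Qed.

Lemma mpoly_alg_ind (K : fieldType) (m : nat) (S : {mpoly K[m]} -> Prop) :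
    S 1 -> (forall k a b, S a -> S b -> S (k *: a + b)) ->
    (forall a b, S a -> S b -> S (a * b)) -> (forall i, S 'X_i) ->
  forall p, S p.
Proof.
move=> S1 SL SM SX; elim/mpolyind.
  (* [S 0] comes from 0 = (-1) *: 1 + 1. *)
  by rewrite -(addNr 1) -scaleN1r; apply: SL.
move=> c al p _ _ Sp; apply: SL => //.
rewrite mpolyXE_id; apply: big_ind => // i _.
by elim: (al i) => [|k IH]; rewrite ?expr0 // exprS; apply: SM.
Qed.

Lemma weyl_poly_ind (K : fieldType) (n m : nat) (W : algType K)
    (w : 'I_(n + n) -> W) (A : algType K) (iW : {lrmorphism W -> A})
    (iP : {lrmorphism {mpoly K[m]} -> A}) (S : A -> Prop) :
    is_weyl_algebra w -> is_tensor_algebra iW iP ->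
    S 1 -> (forall k a b, S a -> S b -> S (k *: a + b)) ->
    (forall a b, S a -> S b -> S (a * b)) ->
    (forall i, S (weyl_poly_gen w iW iP i)) ->
  forall a, S a.
Proof.
move=> hW hA S1 SL SM Sx; apply: (tensor_algebra_ind hA) => //.
  apply: (weyl_algebra_ind hW) => [|k a b|a b|i].
  - by rewrite rmorph1.
  - by rewrite linearP; apply: SL.
  - by rewrite rmorphM; apply: SM.
  - have := Sx (lshift m i).
    by rewrite /weyl_poly_gen -[lshift m i]/(unsplit (inl i)) unsplitK.
apply: mpoly_alg_ind => [|k a b|a b|i].
- by rewrite rmorph1.
- by rewrite linearP; apply: SL.
- by rewrite rmorphM; apply: SM.
- have := Sx (rshift (n + n) i).
  by rewrite /weyl_poly_gen -[rshift _ i]/(unsplit (inr i)) unsplitK.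
Qed.

(** Scalar commutators are what [adrC] needs from the Weyl relations. *)
Lemma weyl_commutator_scalar (K : fieldType) (n : nat) (R : algType K)
    (x : 'I_(n + n) -> R) (i j : 'I_(n + n)) :
  weyl_relations x -> exists c : K, commutator (x i) (x j) = c%:A.
Proof.
move=> relx; have swap (u v : R) c : commutator u v = c%:A ->
    commutator v u = (- c)%:A.
  by rewrite /commutator => e; rewrite scaleNr -e opprB.
case: (split_ordP i) => i' ->; case: (split_ordP j) => j' ->.
- by have [_ -> _] := relx i' j'; exists 0; rewrite scale0r.
- exists (- (j' == i')%:R); apply: swap.
  by have [-> _ _] := relx j' i'; rewrite scaler_nat.
- by have [-> _ _] := relx i' j'; exists (i' == j')%:R; rewrite scaler_nat.
- by have [_ _ ->] := relx i' j'; exists 0; rewrite scale0r.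
Qed.

Lemma weyl_poly_commutator_scalar (K : fieldType) (n m : nat) (W : algType K)
    (w : 'I_(n + n) -> W) (A : algType K) (iW : {lrmorphism W -> A})
    (iP : {lrmorphism {mpoly K[m]} -> A}) (i j : 'I_(n + n + m)) :
    is_weyl_algebra w -> is_tensor_algebra iW iP ->
  exists c : K, commutator (weyl_poly_gen w iW iP i)
    (weyl_poly_gen w iW iP j) = c%:A.
Proof.
move=> [relw _] [comm _]; rewrite /weyl_poly_gen /commutator.
case: (split i) => i'; case: (split j) => j'.
- have [c e] := weyl_commutator_scalar i' j' relw.
  by exists c; rewrite -!rmorphM -rmorphB /= [w _ * _ - _]e linearZ rmorph1.
- by exists 0; rewrite comm subrr scale0r.
- by exists 0; rewrite comm subrr scale0r.
- by exists 0; rewrite -!rmorphM mulrC subrr scale0r.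
Qed.

Lemma mnm_ind (s : nat) (P : 'X_{1..s} -> Prop) :
    P 0%MM -> (forall al i, P al -> P (al + U_(i))%MM) ->
  forall al, P al.
Proof.
move=> P0 PS al; move: {2}(mdeg al) (erefl (mdeg al)) => k.
elim: k al => [|k IH] al.
  by move/eqP; rewrite mdeg_eq0 => /eqP ->.
move=> degal; have [i ali] : exists i, al i != 0%N.
  apply/existsP; rewrite -negb_forall; apply/negP => /forallP al0.
  by move: degal; rewrite mdegE big1 // => i _; apply/eqP.
rewrite -lep1mP in ali; rewrite -(submK ali); apply/PS/IH.
by have := congr1 mdeg (submK ali); rewrite mdegD mdeg1 degal addn1 => -[].
Qed.

(** * Series in a locally nilpotent endomorphism *)

Section EndoTheory.
Variables (K : fieldType) (A : algType K).
Implicit Types (u v p : endo A) (c : nat -> endo A).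

Lemma endoME u v b : (u * v) b = u (v b). Proof. by []. Qed.

Lemma endoDE u v b : (u + v) b = u b + v b. Proof. by []. Qed.

Lemma endoBE u v b : (u - v) b = u b - v b. Proof. by []. Qed.

Lemma endoZE (k : K) u b : (k *: u) b = k *: u b. Proof. by []. Qed.

Lemma endo_sumE (I : Type) (r : seq I) (P : pred I) (F : I -> endo A) b :
  (\sum_(i <- r | P i) F i) b = \sum_(i <- r | P i) F i b.
Proof. exact: (big_morph (fun u : endo A => u b)). Qed.

Lemma expr_endo_eq0 p k l b : (p ^+ k) b = 0 -> (k <= l)%N -> (p ^+ l) b = 0.
Proof. by move=> pk0 /subnK <-; rewrite exprD endoME pk0 linear0. Qed.

Lemma endo_of_linear (f : A -> A) : linear f -> exists u : endo A, u =1 f.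
Proof.
move=> flin.
pose F : {linear A -> A} := HB.pack f (GRing.isLinear.Build K A A _ f flin).
by exists (Endo F).
Qed.

Definition locally_nilpotent p := forall b, exists k, (p ^+ k) b = 0.

(** On each vector only finitely many powers of [p] act nontrivially, so arbitrary coefficients
    define an endomorphism, whatever truncation is used. *)
Lemma locally_finite_sum p c : locally_nilpotent p ->
  exists v : endo A,
    forall k b, (p ^+ k) b = 0 -> v b = \sum_(l < k) c l ((p ^+ l) b).
Proof.
move=> pnil.
have nil b : exists k, (p ^+ k) b == 0 by have [k /eqP] := pnil b; exists k.
(* The least annihilating exponent is the cut-off; a larger one only adds zero terms. *)
pose f b := \sum_(l < ex_minn (nil b)) c l ((p ^+ l) b).
have fE k b : (p ^+ k) b = 0 -> f b = \sum_(l < k) c l ((p ^+ l) b).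
  move=> pk0; rewrite /f; case: ex_minnP => N /eqP pN0 /(_ k).
  rewrite pk0 eqxx => /(_ isT) leNk.
  rewrite -!(big_mkord xpredT (fun l => c l ((p ^+ l) b))).
  rewrite [RHS](@big_cat_nat _ _ _ N) //=.
  rewrite [X in _ + X]big_nat_cond [X in _ + X]big1 ?addr0 //.
  by move=> l /andP[/andP[leNl _] _]; rewrite (expr_endo_eq0 pN0 leNl) linear0.
have [|v vE] := @endo_of_linear f; last first.
  by exists v => k b pk0; rewrite vE; apply: fE.
move=> t a b; have [[k pka] [l plb]] := (pnil a, pnil b).
have pa := expr_endo_eq0 pka (leq_maxl k l).
have pb := expr_endo_eq0 plb (leq_maxr k l).
rewrite (fE _ _ pa) (fE _ _ pb) (fE (maxn k l)); last first.
  by rewrite linearP pa pb scaler0 addr0.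
by rewrite scaler_sumr -big_split; apply: eq_bigr => i _; rewrite !linearP.
Qed.

(** The tail is again a series of this kind, times p^k on the right; this turns pointwise summation
    into convergence for the ideals m^[k]. *)
Lemma locally_finite_sum_tail p c v : locally_nilpotent p ->
    (forall k b, (p ^+ k) b = 0 -> v b = \sum_(l < k) c l ((p ^+ l) b)) ->
  forall k, exists w, v = \sum_(l < k) c l * p ^+ l + w * p ^+ k.
Proof.
move=> pnil vE k.
have [w wE] := locally_finite_sum (fun l => c (k + l)%N) pnil.
exists w; apply: endoP => b; have [l plb] := pnil b.
have pkl : (p ^+ (k + l)) b = 0 by apply: expr_endo_eq0 plb (leq_addl _ _).
rewrite (vE _ _ pkl) big_split_ord /= endo_sumE; congr (_ + _).
rewrite (wE l) => [|]; last by move: pkl; rewrite addnC exprD.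
by apply: eq_bigr => i _; rewrite addnC exprD.
Qed.

Lemma K_derivation1 (B : algType K) (f : B -> B) : K_derivation f -> f 1 = 0.
Proof.
move=> [_ /(_ 1 1)]; rewrite !mulr1 mul1r => e.
by apply: (@addrI _ (f 1)); rewrite -e addr0.
Qed.

End EndoTheory.

(** * The left ideals m^[k]: closure properties, separatedness, unique limits *)

Section Ideals.
Variables (K : fieldType) (s : nat) (A : algType K) (d : 'I_s -> endo A).
Implicit Types (u v : endo A) (al be : 'X_{1..s}).

Lemma mideal_add_gen k c al u :
  (k <= mdeg al)%N -> mideal d k u -> mideal d k (c * dpow d al + u).
Proof.
move=> leal [r [g [/allP ler ->]]].
(* [mideal] allows one coefficient per multi-index, while [r] may already contain [al], even
   repeatedly; these occurrences are merged with the new one. *)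
pose h be := if be == al then c + \sum_(ga <- r | ga == al) g ga else g be.
exists (al :: [seq be <- r | be != al]), h; split.
  by rewrite /= leal; apply/allP => be; rewrite mem_filter => /andP[_ /ler].
rewrite big_cons big_filter /h eqxx mulrDl -addrA; congr (_ + _).
rewrite (bigID (pred1 al)) /= mulr_suml; congr (_ + _); apply: eq_bigr => be.
  by move=> /eqP ->.
by move=> /negPf ->.
Qed.

Lemma mideal0 k : mideal d k 0.
Proof. by exists [::], (fun=> 0); rewrite big_nil. Qed.

Lemma mideal_gen k c al : (k <= mdeg al)%N -> mideal d k (c * dpow d al).
Proof. by move=> leal; rewrite -[_ * _]addr0; apply/mideal_add_gen/mideal0. Qed.

Lemma midealD k u v : mideal d k u -> mideal d k v -> mideal d k (u + v).
Proof.
move=> [r [g [ler ->]]] vk; elim: r ler => [|al r IH] /=.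
  by rewrite big_nil add0r.
by case/andP=> leal ler; rewrite big_cons -addrA; apply/mideal_add_gen/IH.
Qed.

Lemma mideal_sum k (I : eqType) (r : seq I) (F : I -> endo A) :
  (forall i, i \in r -> mideal d k (F i)) -> mideal d k (\sum_(i <- r) F i).
Proof.
move=> Fk; rewrite big_seq; apply: big_ind => //; first exact: mideal0.
by move=> u v; apply: midealD.
Qed.

Lemma midealMl k u v : mideal d k v -> mideal d k (u * v).
Proof.
move=> [r [g [/allP ler ->]]]; rewrite mulr_sumr; apply: mideal_sum => al /ler.
by rewrite mulrA; apply: mideal_gen.
Qed.

Lemma midealN k u : mideal d k u -> mideal d k (- u).
Proof. by rewrite -mulN1r; apply: midealMl. Qed.

Lemma midealB k u v : mideal d k u -> mideal d k v -> mideal d k (u - v).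
Proof. by move=> uk /midealN; apply: midealD. Qed.

Lemma midealZ k t u : mideal d k u -> mideal d k (t *: u).
Proof. by rewrite -[u in t *: u]mul1r scalerAl; apply: midealMl. Qed.

Lemma mideal_le k l u : (k <= l)%N -> mideal d l u -> mideal d k u.
Proof.
move=> lekl [r [g [/allP ler ->]]]; apply: mideal_sum => al /ler leal.
exact/mideal_gen/(leq_trans lekl).
Qed.

Lemma dpow0 : dpow d 0%MM = 1.
Proof. by rewrite /dpow big1 // => i _; rewrite mnm0E. Qed.

Lemma mideal_full u : mideal d 0 u.
Proof. by rewrite -[u]mulr1 -dpow0; apply: mideal_gen. Qed.

Lemma dpow1 i : dpow d U_(i)%MM = d i.
Proof.
rewrite -[RHS](big_pred1_eq *%R i d) big_mkcond; apply: eq_bigr => j _.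
by rewrite mnm1E eq_sym; case: eqP.
Qed.

Hypothesis dC : forall i j, d i * d j = d j * d i.

Lemma dpowD al be : dpow d (al + be)%MM = dpow d al * dpow d be.
Proof.
rewrite /dpow -prodrM_comm => [|i j _ _]; last exact/commrX/commr_sym/commrX.
by apply: eq_bigr => i _; rewrite mnmDE exprD.
Qed.

Lemma dpowMn i l : dpow d (U_(i) *+ l)%MM = d i ^+ l.
Proof.
elim: l => [|l IH]; first by rewrite mulm0n dpow0.
by rewrite mulmSr dpowD exprSr IH dpow1.
Qed.

Lemma mideal_mul_dpow k u al :
  mideal d k u -> mideal d (k + mdeg al) (u * dpow d al).
Proof.
move=> [r [g [/allP ler ->]]]; rewrite mulr_suml; apply: mideal_sum => be /ler.
move=> leal; rewrite -mulrA -dpowD; apply: mideal_gen.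
by rewrite mdegD leq_add2r.
Qed.

Lemma mideal_mulX l u i : mideal d l (u * d i ^+ l).
Proof.
have := mideal_mul_dpow (U_(i) *+ l)%MM (mideal_full u).
by rewrite mdegMn mdeg1 mul1n dpowMn.
Qed.

Hypothesis dnil : forall i, locally_nilpotent (d i).

(** Pigeonhole: if [d i ^+ N i] kills [b] for each i, a multi-index of degree above the sum of the
    N_i has some al_i >= N_i, so d^al kills [b]. The successor in the witness matters when [s] is
    0. *)
Lemma mideal_kill b : exists k, forall u, mideal d k u -> u b = 0.
Proof.
have /choice[N NE] i := dnil i b.
exists (\sum_i N i).+1 => u [r [g [/allP ler ->]]].
rewrite endo_sumE big_seq big1 // => al /ler leal.
have [i leNi] : exists i, (N i <= al i)%N.
  apply/existsP; apply: contraLR leal; rewrite negb_exists => /forallP ltN.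
  by rewrite -leqNgt mdegE; apply: leq_sum => i _; rewrite ltnW // ltnNge.
have leal' : (U_(i) *+ al i <= al)%MM.
  apply/mnm_lepP => j; rewrite mulmnE mnm1E.
  by case: eqP => [<-|_]; rewrite ?mul1n ?mul0n.
rewrite -(submK leal') dpowD dpowMn.
by rewrite !endoME (expr_endo_eq0 (NE i)) ?linear0.
Qed.

Lemma mideal_eq0 u : (forall k, mideal d k u) -> u = 0.
Proof.
by move=> uk; apply: endoP => b; have [k ->] := mideal_kill b.
Qed.

Lemma has_msum_unique (I : eqType) (t : I -> endo A) u v :
  has_msum d t u -> has_msum d t v -> u = v.
Proof.
move=> tu tv; apply/eqP; rewrite -subr_eq0; apply/eqP/mideal_eq0 => k.
have [[r1 r1u] [r2 r2v]] := (tu k, tv k).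
pose r := undup (r1 ++ r2).
have ru : mideal d k (\sum_(i <- r) t i - u).
  by apply: r1u; rewrite ?undup_uniq // => i ir; rewrite mem_undup mem_cat ir.
have rv : mideal d k (\sum_(i <- r) t i - v).
  apply: r2v; rewrite ?undup_uniq // => i ir.
  by rewrite mem_undup mem_cat ir orbT.
by have := midealB rv ru; rewrite opprB addrC addrA subrK.
Qed.

Lemma msumE (I : eqType) (t : I -> endo A) u : has_msum d t u -> msum d t = u.
Proof.
move=> tu; rewrite /msum; case: pselect => [e|[]]; last by exists u.
exact: has_msum_unique (projT2 (cid e)) tu.
Qed.

End Ideals.

(** * Derivations of End_K(A) that vanish on A and are dual to the d_j *)

Definition coeff_derivation (K : fieldType) (s : nat) (A : algType K)
    (d : 'I_s -> endo A) (i : 'I_s) (f : endo A -> endo A) : Prop :=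
  [/\ K_derivation f, forall a, f (lmul a) = 0
    & forall j, f (d j) = (i == j)%:R].

Section CoeffDerivation.
Variables (K : fieldType) (s : nat) (A : algType K) (d : 'I_s -> endo A).
Hypothesis dC : forall i j, d i * d j = d j * d i.
Variables (i : 'I_s) (f : endo A -> endo A).
Hypothesis hf : coeff_derivation d i f.
Implicit Types (u v : endo A) (al be : 'X_{1..s}).

Let f_lin k u v : f (k *: u + v) = k *: f u + f v.
Proof. by case: hf => [[lin _] _ _]; apply: lin. Qed.

Let fM u v : f (u * v) = f u * v + u * f v.
Proof. by case: hf => [[_ mul] _ _]; apply: mul. Qed.

Lemma coeff_derivationD u v : f (u + v) = f u + f v.
Proof. by rewrite -[u in LHS]scale1r f_lin scale1r. Qed.

Lemma coeff_derivation0 : f 0 = 0.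
Proof. by apply: (@addrI _ (f 0)); rewrite -coeff_derivationD !addr0. Qed.

Lemma coeff_derivationZ k u : f (k *: u) = k *: f u.
Proof. by rewrite -[k *: u]addr0 f_lin coeff_derivation0 addr0. Qed.

(** When [be i] is 0 the truncated subtraction is harmless, since the scalar vanishes. *)
Lemma coeff_derivation_dpow be :
  f (dpow d be) = (be i)%:R *: dpow d (be - U_(i))%MM.
Proof.
have [der _ fd] := hf.
elim/mnm_ind: be => [|be j IH].
  by rewrite dpow0 K_derivation1 // mnm0E scale0r.
rewrite dpowD // dpow1 fM IH fd mnmDE mnm1E -scalerAl -{1}(dpow1 d j) -dpowD //.
have [<-|neij] := eqVneq j i; last first.
  rewrite mulr0 addr0 addn0.
  case: (posnP (be i)) => [->|lt0]; first by rewrite !scale0r.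
  congr (_ *: dpow d _); rewrite [LHS]addmC [(be + _)%MM]addmC addmBA //.
  by rewrite lep1mP -lt0n.
rewrite mulr1 addn1 addmK -natr1 scalerDl scale1r; congr (_ + _).
case: (posnP (be j)) => [->|lt0]; first by rewrite !scale0r.
by rewrite submK // lep1mP -lt0n.
Qed.

(** By the Leibniz rule on c d^al, with c any endomorphism, [f] either acts on c and keeps the
    degree of d^al, or removes one d_i. *)
Lemma coeff_derivation_mideal k u : mideal d k.+1 u -> mideal d k (f u).
Proof.
move=> [r [g [/allP ler ->]]]; elim: r ler => [|al r IH] ler.
  by rewrite big_nil coeff_derivation0; apply: mideal0.
rewrite big_cons coeff_derivationD; apply: midealD; last first.
  by apply: IH => be ber; apply: ler; rewrite inE ber orbT.
have {IH}leal : (k < mdeg al)%N by apply: ler; rewrite inE eqxx.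
rewrite fM; apply: midealD; first exact/mideal_gen/ltnW.
rewrite coeff_derivation_dpow; case: (posnP (al i)) => [->|lt0].
  by rewrite scale0r mulr0; apply: mideal0.
rewrite -scalerAr; apply/midealZ/mideal_gen.
have := congr1 mdeg (@submK _ U_(i)%MM al _); rewrite mdegD mdeg1 addn1 => e.
by rewrite -ltnS e // lep1mP -lt0n.
Qed.

Lemma coeff_derivation_iter_mideal k l u :
  mideal d (l + k) u -> mideal d k (iter l f u).
Proof.
elim: l k => [|l IH] k //= lku; apply/coeff_derivation_mideal/IH.
by rewrite addnS -addSn.
Qed.

Lemma coeff_derivation_iter_dpow c l be :
  iter l f (lmul c * dpow d be) =
    (be i ^_ l)%:R *: (lmul c * dpow d (be - U_(i) *+ l)%MM).
Proof.
elim: l => [|l IH] /=.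
  rewrite ffactn0 scale1r; congr (_ * dpow d _).
  by apply/mnmP => j; rewrite mnmBE mulmnE muln0 subn0.
have [_ fc _] := hf.
rewrite IH coeff_derivationZ fM fc mul0r add0r coeff_derivation_dpow.
rewrite -scalerAr scalerA -natrM mnmBE mulmnE mnm1E eqxx mul1n -ffactnSr.
congr (_ *: (_ * dpow d _)); apply/mnmP => j.
by rewrite !mnmBE !mulmnE mulnS addnC subnDA.
Qed.

End CoeffDerivation.

(** * The operators Psi_i as convergent series *)

Definition psi_coef (K : fieldType) (s : nat) (A : algType K)
    (D : 'I_s -> endo A -> endo A) (i : 'I_s) (u : endo A) (l : nat) : endo A :=
  ((-1) ^+ l * (l`!)%:R^-1) *: iter l (D i) u.

Section Psi.
Variables (K : fieldType) (s : nat) (A : algType K) (d : 'I_s -> endo A).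
Hypothesis dC : forall i j, d i * d j = d j * d i.
Hypothesis dnil : forall i, locally_nilpotent (d i).
Variable D : 'I_s -> endo A -> endo A.

(** [msum] is 0 on divergent sums, so convergence must be shown before Psi_i can be computed. The
    limit is the pointwise sum, finite on each vector because d_i is locally nilpotent. *)
Lemma Psi_spec i u : exists v,
  [/\ Psi_ d D i u = v,
      forall k b, (d i ^+ k) b = 0 ->
        v b = \sum_(l < k) psi_coef D i u l ((d i ^+ l) b)
    & mideal d 1 (v - u)].
Proof.
have [v vE] := locally_finite_sum (psi_coef D i u) (dnil i).
have vtail := locally_finite_sum_tail (dnil i) vE.
exists v; split=> //.
  (* Once [r] contains all l < k, its sum differs from [v] by terms with l >= k and by the tail of
     [v], all in m^[k]. *)
  apply: (msumE dC dnil) => k; exists (iota 0 k) => r runiq r0r.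
  have [w ->] := vtail k.
  have termE l : (-1) ^+ l *: (iter l (D i) u * ((l`!)%:R^-1 *: d i ^+ l)) =
      psi_coef D i u l * d i ^+ l.
    by rewrite -scalerAr scalerA -scalerAl.
  rewrite (eq_bigr _ (fun l _ => termE l)) (bigID (fun l => (l < k)%N)) /=.
  have -> : \sum_(l <- r | (l < k)%N) psi_coef D i u l * d i ^+ l =
      \sum_(l < k) psi_coef D i u l * d i ^+ l.
    rewrite -(big_mkord xpredT (fun l => psi_coef D i u l * d i ^+ l)).
    rewrite -[LHS]big_filter /index_iota subn0; apply: perm_big; apply: uniq_perm.
    - exact: filter_uniq.
    - exact: iota_uniq.
    move=> l; rewrite mem_filter mem_iota /= add0n.
    by apply: andb_idr => ltlk; apply: r0r; rewrite mem_iota.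
  rewrite opprD addrACA subrr add0r; apply: midealB.
    rewrite -big_filter; apply: mideal_sum => l; rewrite mem_filter -leqNgt.
    case/andP=> lekl _; apply: (mideal_le lekl).
    exact: mideal_mulX.
  exact: mideal_mulX.
(* With cut-off 1 only the term l = 0 is kept, and it is [u] itself. *)
have [w ->] := vtail 1; rewrite big_ord1 /psi_coef /= expr0 mul1r fact0 invr1.
rewrite scale1r mulr1 addrC addKr.
exact: mideal_mulX.
Qed.

Lemma Psi_E i u k b : (d i ^+ k) b = 0 ->
  Psi_ d D i u b =
    \sum_(l < k) ((-1) ^+ l * (l`!)%:R^-1) *: iter l (D i) u ((d i ^+ l) b).
Proof. by have [v [-> vE _]] := Psi_spec i u; apply: vE. Qed.

Lemma Psi_mideal1 i u : mideal d 1 (Psi_ d D i u - u).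
Proof. by have [v [-> _]] := Psi_spec i u. Qed.

Lemma Psi_comp_mideal1 (r : seq 'I_s) u :
  mideal d 1 ((\big[comp/idfun]_(i <- r) Psi_ d D i) u - u).
Proof.
elim: r => [|i r IH]; first by rewrite big_nil subrr; apply: mideal0.
rewrite big_cons /=; set v := (X in Psi_ d D i X).
by rewrite -[_ - u](subrKA v); apply: midealD => //; apply: Psi_mideal1.
Qed.

End Psi.

(** * Right multiplications R_i, the derivations [u, R_i], and Psi formed with them *)

Definition rmul (K : fieldType) (A : algType K) (y : A) : endo A :=
  Endo (y \o* idfun : {linear A -> A}).

Definition adr (K : fieldType) (s : nat) (A : algType K) (x : 'I_s -> A)
    (i : 'I_s) (u : endo A) : endo A :=
  u * rmul (x i) - rmul (x i) * u.

Section Coordinates.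
Variables (K : fieldType) (s : nat) (A : algType K).
Variables (x : 'I_s -> A) (d : 'I_s -> endo A).
Hypothesis charK : [pchar K] =i pred0.
Hypothesis hd : formal_partials x d.
Hypothesis x_comm : forall i j, exists c : K, commutator (x i) (x j) = c%:A.
Hypothesis x_gen : forall S : A -> Prop,
  S 1 -> (forall k a b, S a -> S b -> S (k *: a + b)) ->
  (forall a b, S a -> S b -> S (a * b)) -> (forall i, S (x i)) ->
  forall a, S a.
Implicit Types (u v : endo A) (al be : 'X_{1..s}).

Let dC i j : d i * d j = d j * d i.
Proof. by case: hd. Qed.

Let dnil i : locally_nilpotent (d i).
Proof. by case: hd => _ _ _ nil b; apply: nil. Qed.

Let d1 i : d i 1 = 0.
Proof. by case: hd => der _ _ _; apply: K_derivation1. Qed.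

Lemma adrE i u b : adr x i u b = u (b * x i) - u b * x i.
Proof. by []. Qed.

Lemma adr_partial i j : adr x i (d j) = (i == j)%:R.
Proof.
case: hd => der dx _ _; apply: endoP => b; rewrite adrE.
have [_ ->] := der j; rewrite dx addrC addKr eq_sym.
by case: eqP; rewrite ?mulr1 ?mulr0.
Qed.

Lemma adr_coeff_derivation i : coeff_derivation d i (adr x i).
Proof.
split; [split| |].
- move=> k u v; apply: endoP => b.
  rewrite [RHS]endoDE endoZE !adrE !endoDE !endoZE.
  by rewrite mulrDl opprD addrACA scalerBr scalerAl.
- by move=> u v; rewrite /adr mulrBl mulrBr !mulrA [RHS]addrC addrA subrK.
- by move=> a; apply: endoP => b; rewrite adrE /= mulrA subrr.
- exact: adr_partial.
Qed.

(** Jacobi identity: [R_i, R_j] is a scalar, hence commutes with the K-linear [u]. In coordinates,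
    [c *: u b] appears once on each side. *)
Lemma adrC i j u : adr x i (adr x j u) = adr x j (adr x i u).
Proof.
apply: endoP => b; rewrite !adrE.
have [c] := x_comm i j; rewrite /commutator => e.
have xij : x i * x j = c%:A + x j * x i by rewrite -e subrK.
have e1 : u (b * x i * x j) = c *: u b + u (b * x j * x i).
  by rewrite -mulrA xij mulrDr linearD -scalerAr mulr1 linearZ mulrA.
have e2 : u b * x i * x j = c *: u b + u b * x j * x i.
  by rewrite -mulrA xij mulrDr -scalerAr mulr1 mulrA.
rewrite e1 !mulrBl e2 !opprB !addrA.
by rewrite [LHS](ACl (2 * 5 * 1 * 4 * 3)%AC).
Qed.

Lemma adr_iter i j l u :
  adr x j (iter l (adr x i) u) = iter l (adr x i) (adr x j u).
Proof. by elim: l => //= l IH; rewrite adrC IH. Qed.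

Local Notation Psi_x := (Psi_ d (adr x)).

(** As d_i(x_j) is constant, the Leibniz expansion has only two terms; at l = 0 the second has
    multiplicity 0. *)
Lemma partial_iter_mul i j l b :
  (d i ^+ l) (b * x j) = (d i ^+ l) b * x j + (d i ^+ l.-1) b *+ ((i == j) * l).
Proof.
elim: l => [|l IH]; first by rewrite muln0 addr0.
rewrite !exprS !endoME IH linearD linearMn.
have [[_ dM] dx] : K_derivation (d i) /\ d i (x j) = (i == j)%:R by case: hd.
rewrite dM dx -addrA; congr (_ + _).
case: (i == j); last by rewrite mulr0 !mul0n !mulr0n addr0.
rewrite mulr1 !mul1n mulrS; congr (_ + _).
by case: l {IH} => [|l]; rewrite ?mulr0n // exprS.
Qed.

(** Telescoping: [., R_i] splits the l-th term of Psi_i(u) into one with the coefficient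
    differentiated and one with d_i^l replaced by l d_i^(l-1). The second part of term l+1 cancels
    the first part of term l. *)
Lemma adr_Psi_same i u : adr x i (Psi_x i u) = 0.
Proof.
apply: endoP => b; have [k dk0] := dnil i b; rewrite adrE.
(* One power more than for [b], since d_i^k(b x_i) may still contain k d_i^(k-1)(b). *)
have dk1 := expr_endo_eq0 dk0 (leqnSn k).
have dkx : (d i ^+ k.+1) (b * x i) = 0.
  by rewrite partial_iter_mul dk1 dk0 mul0r mul0rn addr0.
rewrite (Psi_E dC dnil _ _ dk1) (Psi_E dC dnil _ _ dkx).
under eq_bigr do rewrite partial_iter_mul eqxx mul1n linearD scalerDr.
(* The first family loses its last term as d_i^k(b) = 0, the second its first term, of multiplicity
   0; then l is matched with l+1. *)
rewrite big_split mulr_suml /= addrAC -sumrB big_ord_recr /= dk0.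
rewrite mul0r !linear0 !mul0r ?scaler0 subr0 addr0.
rewrite big_ord_recl /= mulr0n linear0 ?scaler0 add0r -big_split.
rewrite big1 // => l _ /=.
rewrite -scalerAl -scalerBr.
rewrite -[iter l _ u (_ * _) - _]/(adr x i (iter l (adr x i) u) _).
rewrite add0n -adrE linearMn -scaler_nat scalerA -scalerDl /bump /= add1n.
rewrite exprS factS natrM invfM -!mulrA [_^-1 * _%:R]mulrC.
by rewrite mulKf ?(pcharf0P K).1 // mulN1r addrN scale0r.
Qed.

(** Here d_i(x_j) = 0, so R_j commutes with d_i; the coefficients are handled by [adr_iter]. *)
Lemma adr_Psi_neq i j u : i != j -> adr x j (Psi_x i u) = Psi_x i (adr x j u).
Proof.
move=> neij; apply: endoP => b; have [k dk0] := dnil i b; rewrite adrE.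
have dR l : (d i ^+ l) (b * x j) = (d i ^+ l) b * x j.
  by rewrite partial_iter_mul (negPf neij) addr0.
have dkx : (d i ^+ k) (b * x j) = 0 by rewrite dR dk0 mul0r.
rewrite (Psi_E dC dnil _ _ dk0) !(Psi_E dC dnil _ _ dk0).
rewrite (Psi_E dC dnil _ _ dkx) mulr_suml -sumrB; apply: eq_bigr => l _.
by rewrite dR -scalerAl -scalerBr -adr_iter.
Qed.

(** [., R_j] moves inward past each Psi_i with i <> j until it meets Psi_j and gives 0, which every
    Psi_i preserves. *)
Lemma adr_Psi_comp j (r : seq 'I_s) u : j \in r ->
  adr x j ((\big[comp/idfun]_(i <- r) Psi_x i) u) = 0.
Proof.
elim: r => // i r IH; rewrite inE big_cons /= => jr.
have [->|neji] := eqVneq j i; first exact: adr_Psi_same.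
move: jr; rewrite (negPf neji) => /IH IHr.
rewrite adr_Psi_neq 1?eq_sym // IHr; apply: endoP => b.
have [k dk0] := dnil i b.
rewrite (Psi_E dC dnil _ _ dk0) big1 // => l _.
have -> : iter l (adr x i) 0 = 0.
  elim: (nat_of_ord l) => //= ? ->.
  exact: coeff_derivation0 (adr_coeff_derivation i).
by rewrite scaler0.
Qed.

Lemma mideal1_at1 u : mideal d 1 u -> u 1 = 0.
Proof.
move=> [r [g [/allP ler ->]]]; rewrite endo_sumE big_seq.
rewrite big1 // => al /ler leal.
have [i ali] : exists i, al i != 0%N.
  apply/existsP; rewrite -negb_forall; apply/negP => /forallP al0.
  by move: leal; rewrite mdegE big1 // => i _; apply/eqP.
rewrite -lep1mP in ali; rewrite -(submK ali) dpowD // dpow1 !endoME d1.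
by rewrite !linear0.
Qed.

Lemma adr_eq0_lmul u : (forall i, adr x i u = 0) -> u = lmul (u 1).
Proof.
move=> ux; apply: endoP => a.
suff uM b : u (b * a) = u b * a by rewrite -[in LHS](mul1r a) uM.
(* Keeping [b] universal lets products through: the hypothesis for the right factor is used at
   [b * a]. *)
move: a b; apply: x_gen => [b|k a a' ua ua' b|a a' ua ua' b|i b].
- by rewrite !mulr1.
- by rewrite !mulrDr linearD ua' -!scalerAr linearZ ua.
- by rewrite !mulrA ua' ua.
- by apply/eqP; rewrite -subr_eq0 -adrE ux.
Qed.

Lemma Psi_adrE u : Psi d (adr x) u = lmul (u 1).
Proof.
have -> : u 1 = Psi d (adr x) u 1.
  apply/eqP; rewrite eq_sym -subr_eq0 -endoBE; apply/eqP.
  exact/mideal1_at1/Psi_comp_mideal1.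
by apply: adr_eq0_lmul => i; apply: adr_Psi_comp; rewrite mem_index_enum.
Qed.

(** * Density of finite series and uniqueness of D_i *)

Lemma endo_lmul_mideal1 u : mideal d 1 (u - lmul (u 1)).
Proof.
by rewrite -Psi_adrE -opprB; apply/midealN/Psi_comp_mideal1.
Qed.

(** Replacing each coefficient of an element of m^[k] by left multiplication by its value at 1 costs
    an error in m^[k+1]. So [P] descends from m^[k+1] to m^[k], and finally to m^[0], which is
    everything. *)
Lemma endo_dense_ind k (P : endo A -> Prop) :
    (forall u v, P u -> P v -> P (u + v)) ->
    (forall c be, P (lmul c * dpow d be)) ->
    (forall u, mideal d k u -> P u) ->
  forall u, P u.
Proof.
move=> PD Pd; elim: k => [|k IH] Pk u; first exact/Pk/mideal_full.
apply: IH => {}u [r [g [/allP ler ->]]].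
rewrite big_seq; apply: big_ind => //; first exact/Pk/mideal0.
move=> al /ler leal; rewrite -(subrK (lmul (g al 1)) (g al)) mulrDl.
apply: PD => //.
apply/Pk/(mideal_le (l := 1 + mdeg al)); first by rewrite add1n.
exact/mideal_mul_dpow/endo_lmul_mideal1.
Qed.

Lemma coeff_derivation_unique i f : coeff_derivation d i f -> f = adr x i.
Proof.
move=> hf; have := adr_coeff_derivation i; set g := adr x i => hg.
apply/funext => u; apply/eqP; rewrite -subr_eq0; apply/eqP.
apply: (mideal_eq0 dC dnil) => k; move: u; apply: (@endo_dense_ind k).
- move=> u v uk vk; rewrite (coeff_derivationD hf) (coeff_derivationD hg).
  by rewrite opprD addrACA; apply: midealD.
- have [[_ fM] f0 _] := hf; have [[_ gM] g0 _] := hg => c be.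
  rewrite fM gM f0 g0 (coeff_derivation_dpow dC hf).
  by rewrite (coeff_derivation_dpow dC hg) subrr; apply: mideal0.
have [[_ fM] _ _] := hf; have [[_ gM] _ _] := hg.
move=> u [r [h [/allP ler ->]]]; elim: r ler => [|al r IH] ler.
  rewrite big_nil (coeff_derivation0 hf) (coeff_derivation0 hg) subrr.
  exact: mideal0.
rewrite big_cons (coeff_derivationD hf) (coeff_derivationD hg) opprD addrACA.
apply: midealD; last by apply: IH => be ber; apply: ler; rewrite inE ber orbT.
(* Both derivations agree on d^al, so those parts cancel and the difference stays in m^[k] without
   loss of degree. *)
rewrite fM gM (coeff_derivation_dpow dC hf) (coeff_derivation_dpow dC hg).
rewrite opprD addrACA subrr addr0 -mulrBl; apply: mideal_gen.
by apply: ler; rewrite inE eqxx.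
Qed.

(** * Iterated derivations and Taylor coefficients *)

Local Notation Dlist r al :=
  (\big[comp/idfun]_(i <- r) iter (al i) (adr x i)).

Lemma Dlist_linear r al k u v :
  Dlist r al (k *: u + v) = k *: Dlist r al u + Dlist r al v.
Proof.
elim: r => [|i r IH]; first by rewrite !big_nil.
rewrite !big_cons /= IH; elim: (al i) => //= l ->.
by have [[lin _] _ _] := adr_coeff_derivation i; rewrite lin.
Qed.

Lemma Dlist_mideal r al k u :
  mideal d (\sum_(i <- r) al i + k) u -> mideal d k (Dlist r al u).
Proof.
elim: r k => [|i r IH] k; first by rewrite !big_nil.
rewrite !big_cons /= [(al i + _)%N]addnC -addnA => /IH.
exact/coeff_derivation_iter_mideal/adr_coeff_derivation.
Qed.

Lemma Dlist_dpow r al be c : uniq r ->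
  Dlist r al (lmul c * dpow d be) =
    (\prod_(i <- r) be i ^_ al i)%:R *:
      (lmul c * dpow d (be - \sum_(i <- r) U_(i) *+ al i)%MM).
Proof.
elim: r => [|i r IH] /=.
  by rewrite !big_nil scale1r subm0.
case/andP=> ir /IH {}IH; rewrite !big_cons /= IH.
have hi := adr_coeff_derivation i.
have -> k l u : iter l (adr x i) (k *: u) = k *: iter l (adr x i) u.
  by elim: l => //= l ->; rewrite (coeff_derivationZ hi).
rewrite (coeff_derivation_iter_dpow dC hi) scalerA -natrM mulnC.
congr ((_ * _)%:R *: (_ * dpow d _)).
  (* As [i] is not in [r], the derivations already applied leave the exponent of d_i unchanged. *)
  rewrite mnmBE mnm_sumE big_seq big1 ?subn0 // => j jr.
  by rewrite mulmnE mnm1E; case: eqP ir => [<-|]; rewrite ?jr ?mul0n.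
by apply/mnmP => j; rewrite !mnmBE mnmDE addnC subnDA.
Qed.

(** If al = be the factorials cancel, by characteristic 0; if some be_i < al_i a falling factorial
    vanishes; otherwise a nontrivial d^(be - al) remains and kills 1. *)
Lemma taylor_at1 al be c :
  (mfactorial al)%:R^-1 *: Dpow (adr x) al (lmul c * dpow d be) 1 =
    (al == be)%:R * c.
Proof.
rewrite /Dpow Dlist_dpow ?index_enum_uniq // -multinomUE_id.
rewrite endoZE endoME scalerA -[lmul c _]/(c * _).
have [<-|neab] := eqVneq al be.
  have -> : (al - al)%MM = 0%MM by apply/mnmP => i; rewrite mnmBE subnn mnm0E.
  rewrite dpow0 mul1r -[(1 : endo A) 1]/1 mulr1.
  under eq_bigr do rewrite ffactnn.
  rewrite mulVf ?scale1r // (pcharf0P K).1 //.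
  by rewrite -lt0n prodn_gt0 // => i; apply: fact_gt0.
rewrite mul0r.
have [/mnm_lepP leab|] := boolP (al <= be)%MM; last first.
  move=> nle; have [i lti] : exists i, (be i < al i)%N.
    apply/existsP; apply: contraR nle; rewrite negb_exists => /forallP le.
    by apply/mnm_lepP => i; rewrite leqNgt.
  by rewrite (bigD1 i) //= ffact_small // mul0n mulr0 scale0r.
rewrite mideal1_at1 ?mulr0 ?scaler0 //.
rewrite -[dpow d _]mul1r; apply: mideal_gen.
rewrite lt0n mdeg_eq0; apply: contraNneq neab => e.
by rewrite -[be](submK (introT mnm_lepP leab)) e add0m.
Qed.

Lemma mideal_taylor_sum a k : exists r0 : seq 'X_{1..s},
  forall r, uniq r -> {subset r0 <= r} ->
    mideal d k (\sum_(al <- r)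
      lmul (((mfactorial al)%:R^-1 *: Dpow (adr x) al a) 1) * dpow d al - a).
Proof.
(* All multi-indices of degree below [k]: a choice independent of [a], so that density induction on
   [a] runs with [r] fixed. *)
exists [seq bmnm al | al : 'X_{1..s < k}] => r runiq r0r.
have r_small al : (mdeg al < k)%N -> al \in r.
  by move=> ltk; apply/r0r/mapP; exists (BMultinom ltk); rewrite ?mem_enum.
move: a; apply: (@endo_dense_ind k).
- move=> u v uk vk.
  rewrite [X in mideal d k X](_ : _ = (\sum_(al <- r)
    lmul (((mfactorial al)%:R^-1 *: Dpow (adr x) al u) 1) * dpow d al - u) +
    (\sum_(al <- r)
    lmul (((mfactorial al)%:R^-1 *: Dpow (adr x) al v) 1) * dpow d al - v)).
    exact: midealD.
  rewrite addrACA -opprD -big_split; congr (_ - _); apply: eq_bigr => al _ /=.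
  rewrite -mulrDl; congr (_ * _); apply: endoP => b /=; rewrite -mulrDl.
  congr (_ * _); rewrite -scalerDr; congr (_ *: _).
  have := Dlist_linear (index_enum 'I_s) al 1 u v; rewrite !scale1r.
  exact: (congr1 (fun w : endo A => w 1)).
(* For |be| < k only al = be contributes, and [r] contains it; otherwise c d^be and all terms lie in
   m^[k]. *)
- move=> c be; case: (ltnP (mdeg be) k) => [ltk|lek].
    rewrite (bigD1_seq be) ?r_small //= big1 => [|al nab].
      rewrite addr0 taylor_at1 eqxx mul1r subrr; exact: mideal0.
    rewrite taylor_at1 (negPf nab) mul0r; apply: endoP => b.
    by rewrite endoME /= mul0r.
  apply: midealB; last exact: mideal_gen.
  apply: mideal_sum => al _; rewrite endoZE taylor_at1.
  case: eqP => [->|_]; first exact: mideal_gen.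
  rewrite mul0r [_ * _](_ : _ = 0); first exact: mideal0.
  by apply: endoP => b; rewrite endoME /= mul0r.
(* For |al| >= k the factor d^al is in m^[k]; for |al| < k, D^al(u) is in m^[1] and kills 1, so the
   coefficient is 0. *)
move=> u uk; apply: midealB => //; apply: mideal_sum => al _.
case: (ltnP (mdeg al) k) => [ltk|]; last exact: mideal_gen.
rewrite [X in lmul X](_ : _ = 0).
  rewrite [_ * _](_ : _ = 0); first exact: mideal0.
  by apply: endoP => b; rewrite endoME /= mul0r.
rewrite endoZE mideal1_at1 ?scaler0 //; apply: Dlist_mideal.
by rewrite -mdegE addn1; apply: mideal_le uk.
Qed.

Lemma endo_taylor (D : 'I_s -> endo A -> endo A) a :
    (forall i, coeff_derivation d i (D i)) ->
  has_msum d (fun al : 'X_{1..s} =>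
    Psi d D ((mfactorial al)%:R^-1 *: Dpow D al a) * dpow d al) a.
Proof.
move=> hD; have -> : D = adr x.
  by apply/funext => i; apply: coeff_derivation_unique.
move=> k; have [r0 r0P] := mideal_taylor_sum a k; exists r0 => r runiq r0r.
by under eq_bigr do rewrite Psi_adrE; apply: r0P.
Qed.

End Coordinates.

Theorem theorem7p4 (K : fieldType) (charK : [pchar K] =i pred0) (n m : nat)
    (W : algType K) (w : 'I_(n + n) -> W) (hW : is_weyl_algebra w)
    (A : algType K) (iW : {lrmorphism W -> A})
    (iP : {lrmorphism {mpoly K[m]} -> A}) (hA : is_tensor_algebra iW iP)
    (d : 'I_(n + n + m) -> endo A)
    (hd : formal_partials (weyl_poly_gen w iW iP) d)
    (D : 'I_(n + n + m) -> endo A -> endo A)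
    (hD : forall i, is_D d i (D i))
    (a : endo A) :
  has_msum d
    (fun al : 'X_{1..n + n + m} =>
       Psi d D ((mfactorial al)%:R^-1 *: Dpow D al a) * dpow d al)
    a.
Proof.
(* What is specific to A: its generators have scalar commutators and generate it, both by the
   presentations. *)
apply: (endo_taylor charK hd) => [i j|S S1 SL SM Sx|i].
- exact: weyl_poly_commutator_scalar hW hA.
- exact: weyl_poly_ind hW hA S1 SL SM Sx.
- by have [der c0 dD _] := hD i.
Qed.
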